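(* Let $\mathbb A$ be a distributive monoidal category. In the free cornering with choice $\ulcorner\mathbb A\urcorner^{\oplus}$, for all $U\in\mathbb A^{\circ\bullet}_\oplus$ and $A,B\in\mathbb A_0$, the crossing cells satisfy $\chi_{U,A\oplus B}=\left[\frac{\chi_{U,A}}{\sigma_0},\frac{\chi_{U,B}}{\sigma_1}\right]$. That is, $\chi_{U,A\oplus B}$ is the unique cell such that $$\frac{\sigma_0}{\chi_{U,A\oplus B}}=\frac{\chi_{U,A}}{\sigma_0},\qquad \frac{\sigma_1}{\chi_{U,A\oplus B}}=\frac{\chi_{U,B}}{\sigma_1},$$ where $\sigma_0:A\to A\oplus B$, $\sigma_1:B\to A\oplus B$ are the coproduct injections.
   Context: Monoidal categories are strict, and composites are in diagrammatic order ($fg$ is first $f$, then $g$). $\sigma_{A,B}:A\otimes B\to B\otimes A$ (two object subscripts) is the braiding. A single-object double category $\mathbb D$ has a horizontal edge monoid $(\mathbb D_H,\otimes,I)$, a vertical edge monoid $(\mathbb D_V,\otimes,I)$, and for $A,B\in\mathbb D_H$, $U,W\in\mathbb D_V$ a set of cells $(U;A;B;W)$ (left; top; bottom; right boundary). For $\alpha:(U;A;B;V)$ and $\beta:(V;A';B';W)$ there is a horizontal composite $\alpha\mid\beta:(U;A\otimes A';B\otimes B';W)$; for $\alpha:(U;A;C;W)$ and $\beta:(U';C;B;W')$ a vertical composite $\frac{\alpha}{\beta}:(U\otimes U';A;B;W\otimes W')$. Both are associative and unital, with horizontal units $id_U:(U;I;I;U)$ and vertical units $1_A:(I;A;A;I)$,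 where $id_I=1_I$, $1_{A\otimes B}=1_A\mid 1_B$, $id_{U\otimes W}=\frac{id_U}{id_W}$, and interchange $\frac{\alpha}{\beta}\mid\frac{\gamma}{\delta}=\frac{\alpha\mid\gamma}{\beta\mid\delta}$ holds. A distributive monoidal category $(\mathbb A,\otimes,\oplus,I)$ is a symmetric monoidal category with binary coproducts $A\oplus B$ (injections $\sigma_0,\sigma_1$, copairing $[f,g]$; no initial object required) such that $[\sigma_0\otimes 1_C,\sigma_1\otimes 1_C]:(A\otimes C)\oplus(B\otimes C)\to(A\oplus B)\otimes C$ is invertible for all $A,B,C$. Exchanges with choice: $\mathbb A^{\circ\bullet}_\oplus$ is the monoid (operation $\otimes$, unit $I$) with elements generated by $A^\circ$, $A^\bullet$ ($A\in\mathbb A_0$), $I$, $U\otimes W$, $U\times W$, $U+W$, subject only to associativity and unitality of $\otimes$. Free cornering with choice: $\ulcorner\mathbb A\urcorner^{\oplus}$ is the free single-object double category with horizontal edge monoid $(\mathbb A_0,\otimes,I)$, vertical edge monoid $\mathbb A^{\circ\bullet}_\oplus$, and generating cells and equations: (1) for each $f:A\to B$ in $\mathbb A$ a cell $\ulcorner f\urcorner:(I;A;B;I)$ (also written $f$), with $\ulcorner fg\urcorner=\frac{\ulcorner f\urcorner}{\ulcorner g\urcorner}$, $\ulcorner 1_A\urcorner=1_A$, $\ulcorner f\otimes g\urcorner=\ulcorner f\urcorner\mid\ulcorner g\urcorner$; (2) for each $A\in\mathbb A_0$ corner cells $\mathsf{get}_L^A:(A^\circ;I;A;I)$, $\mathsf{put}_R^A:(I;A;I;A^\circ)$,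 $\mathsf{get}_R^A:(I;I;A;A^\bullet)$, $\mathsf{put}_L^A:(A^\bullet;A;I;I)$ with $\mathsf{put}_R^A\mid\mathsf{get}_L^A=1_A$, $\frac{\mathsf{get}_L^A}{\mathsf{put}_R^A}=id_{A^\circ}$, $\mathsf{get}_R^A\mid\mathsf{put}_L^A=1_A$, $\frac{\mathsf{get}_R^A}{\mathsf{put}_L^A}=id_{A^\bullet}$; (3) for all $U,W$, cells $\pi_0:(U\times W;I;I;U)$, $\pi_1:(U\times W;I;I;W)$, and for $\alpha:(V;A;B;U)$, $\beta:(V;A;B;W)$ a unique cell $\alpha\times\beta:(V;A;B;U\times W)$ with $(\alpha\times\beta)\mid\pi_0=\alpha$, $(\alpha\times\beta)\mid\pi_1=\beta$; (4) for all $U,W$, cells $\iota_0:(U;I;I;U+W)$, $\iota_1:(W;I;I;U+W)$, and for $\alpha:(U;A;B;V)$, $\beta:(W;A;B;V)$ a unique cell $\alpha+\beta:(U+W;A;B;V)$ with $\iota_0\mid(\alpha+\beta)=\alpha$, $\iota_1\mid(\alpha+\beta)=\beta$; (5) for $\alpha:(U;A;C;W)$, $\beta:(U;B;C;W)$ a unique cell $[\alpha,\beta]:(U;A\oplus B;C;W)$ with $\frac{\ulcorner\sigma_0\urcorner}{[\alpha,\beta]}=\alpha$, $\frac{\ulcorner\sigma_1\urcorner}{[\alpha,\beta]}=\beta$. Crossing cells $\chi_{U,B}:(U;B;B;U)$, by induction on $U$: $\chi_{A^\circ,B}$ is the vertical composite (top to bottom) of $\mathsf{get}_L^A\mid 1_B$,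 $\sigma_{A,B}$, $1_B\mid\mathsf{put}_R^A$; $\chi_{A^\bullet,B}$ is the vertical composite (top to bottom) of $1_B\mid\mathsf{get}_R^A$, $\sigma_{B,A}$, $\mathsf{put}_L^A\mid 1_B$; $\chi_{I,B}=1_B$; $\chi_{U\otimes W,B}=\frac{\chi_{U,B}}{\chi_{W,B}}$; $\chi_{U+W,B}=(\chi_{U,B}\mid\iota_0)+(\chi_{W,B}\mid\iota_1)$; $\chi_{U\times W,B}=(\pi_0\mid\chi_{U,B})\times(\pi_1\mid\chi_{W,B})$. *)

(* Defs.v *)
From mathcomp Require Import ssreflect ssrfun ssrbool eqtype choice seq.
From mathcomp Require Import generic_quotient boolp.

Set Implicit Arguments.
Unset Strict Implicit.
Unset Printing Implicit Defensive.

Record monoid := Monoid {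
  mcar :> Type;
  munit : mcar;
  mmul : mcar -> mcar -> mcar;
  mmulA : forall x y z, mmul (mmul x y) z = mmul x (mmul y z);
  mmul1x : forall x, mmul munit x = x;
  mmulx1 : forall x, mmul x munit = x
}.
Arguments munit {m}.

Declare Scope mon_scope.
Delimit Scope mon_scope with M.
Notation "1" := munit : mon_scope.
Notation "x * y" := (mmul x y) : mon_scope.
Local Open Scope mon_scope.

(* Transport of an arrow along equalities of objects; needed because the
   strictness equations only hold propositionally. *)
Definition cast_hom (O : Type) (hom : O -> O -> Type) (A A' B B' : O)
    (eA : A = A') (eB : B = B') (f : hom A B) : hom A' B' :=
  match eA in _ = X, eB in _ = Y return hom X Y with
  | erefl, erefl => f
  end.

(* Composition is diagrammatic: [compm f g] is first f, then g. *)
Record smcat := SMCat {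
  ob : monoid;
  hom : ob -> ob -> Type;
  idm : forall A, hom A A;
  compm : forall A B C, hom A B -> hom B C -> hom A C;
  compA : forall A B C D (f : hom A B) (g : hom B C) (h : hom C D),
    compm (compm f g) h = compm f (compm g h);
  comp1f : forall A B (f : hom A B), compm (idm A) f = f;
  compf1 : forall A B (f : hom A B), compm f (idm B) = f;
  tens : forall A B A' B', hom A B -> hom A' B' -> hom (A * A') (B * B');
  tens1 : forall A B, tens (idm A) (idm B) = idm (A * B);
  tensM : forall A B C A' B' C' (f : hom A B) (g : hom B C)
      (f' : hom A' B') (g' : hom B' C'),
    tens (compm f g) (compm f' g') = compm (tens f f') (tens g g');
  tensA : forall A B A' B' A'' B''
      (f : hom A B) (g : hom A' B') (h : hom A'' B''),
    cast_hom (mmulA A A' A'') (mmulA B B' B'') (tens (tens f g) h)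
      = tens f (tens g h);
  tens1f : forall A B (f : hom A B),
    cast_hom (mmul1x A) (mmul1x B) (tens (idm 1) f) = f;
  tensf1 : forall A B (f : hom A B),
    cast_hom (mmulx1 A) (mmulx1 B) (tens f (idm 1)) = f;
  braid : forall A B, hom (A * B) (B * A);
  braid_nat : forall A B A' B' (f : hom A B) (g : hom A' B'),
    compm (tens f g) (braid B B') = compm (braid A A') (tens g f);
  braid_sym : forall A B, compm (braid A B) (braid B A) = idm (A * B);
  braid_hexagon : forall A B C,
    cast_hom (esym (mmulA A B C)) (mmulA B C A) (braid A (B * C)) =
      compm (tens (braid A B) (idm C))
           (cast_hom (esym (mmulA B A C)) (erefl _)
                     (tens (idm B) (braid A C)))
}.
Arguments hom {s} _ _.
Arguments idm {s} A.
Arguments compm {s A B C} f g.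
Arguments tens {s A B A' B'} f g.
Arguments braid {s} A B.

Record dmcat := DMCat {
  smc :> smcat;
  oplus : ob smc -> ob smc -> ob smc;
  sig0 : forall A B, hom A (oplus A B);
  sig1 : forall A B, hom B (oplus A B);
  copair : forall A B C, hom A C -> hom B C -> hom (oplus A B) C;
  copair0 : forall A B C (f : hom A C) (g : hom B C),
    compm (sig0 A B) (copair f g) = f;
  copair1 : forall A B C (f : hom A C) (g : hom B C),
    compm (sig1 A B) (copair f g) = g;
  copair_uniq : forall A B C (f : hom A C) (g : hom B C)
      (h : hom (oplus A B) C),
    compm (sig0 A B) h = f -> compm (sig1 A B) h = g -> h = copair f g;
  distr : forall A B C,
    let d := copair (tens (sig0 A B) (idm C)) (tens (sig1 A B) (idm C)) in
    exists e : hom (oplus A B * C) (oplus (A * C) (B * C)),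
      compm d e = idm _ /\ compm e d = idm _
}.
Arguments oplus {d} A B.
Arguments sig0 {d} A B.
Arguments sig1 {d} A B.

(* Equality of cells together with their boundaries. *)
Inductive cell_eq (V H : Type) (C : V -> H -> H -> V -> Type)
    (U : V) (A B : H) (W : V) (a : C U A B W) :
    forall (U' : V) (A' B' : H) (W' : V), C U' A' B' W' -> Prop :=
  cell_eq_refl : cell_eq a a.
Notation "a =~ b" := (cell_eq a b) (at level 70, no associativity).

Definition cast_cell (V H : Type) (C : V -> H -> H -> V -> Type)
    (U U' : V) (A A' B B' : H) (W W' : V)
    (eU : U = U') (eA : A = A') (eB : B = B') (eW : W = W')
    (a : C U A B W) : C U' A' B' W' :=
  match eU in _ = u, eA in _ = x, eB in _ = y, eW in _ = w
    return C u x y w with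
  | erefl, erefl, erefl, erefl => a
  end.

Section CellEq.
Variables (V H : Type) (C : V -> H -> H -> V -> Type).

Lemma cell_eq_sym U A B W (a : C U A B W) U' A' B' W' (b : C U' A' B' W') :
  a =~ b -> b =~ a.
Proof. by case. Qed.

Lemma cell_eq_trans U A B W (a : C U A B W) U' A' B' W' (b : C U' A' B' W')
    U'' A'' B'' W'' (c : C U'' A'' B'' W'') :
  a =~ b -> b =~ c -> a =~ c.
Proof. by case. Qed.

Lemma cast_cellE U A B W (a : C U A B W) U' A' B' W'
    (eU : U = U') (eA : A = A') (eB : B = B') (eW : W = W') :
  cast_cell eU eA eB eW a =~ a.
Proof. by case: _ / eU; case: _ / eA; case: _ / eB; case: _ / eW. Qed.

Lemma cell_eqE U A B W (a b : C U A B W) : a =~ b <-> a = b.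
Proof.
split=> [e|->//].
suff H' : forall U' A' B' W' (c : C U' A' B' W'), a =~ c ->
    forall (eU : U = U') (eA : A = A') (eB : B = B') (eW : W = W'),
    cast_cell eU eA eB eW a = c.
  exact: (H' _ _ _ _ _ e erefl erefl erefl erefl).
move=> U' A' B' W' c {b e} [] eU eA eB eW.
by rewrite (Prop_irrelevance eU erefl) (Prop_irrelevance eA erefl)
  (Prop_irrelevance eB erefl) (Prop_irrelevance eW erefl).
Qed.

End CellEq.

(* Cells are indexed by their left, top, bottom and right boundary, in this
   order.  [hcomp a b] is a | b, and [vcomp a b] is a on top of b. *)
Record sodcat (DH DV : monoid) := SODCat {
  cell :> DV -> DH -> DH -> DV -> Type;
  hid : forall U, cell U 1 1 U;
  vid : forall A, cell 1 A A 1;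
  hcomp : forall (U V W : DV) (A A' B B' : DH),
    cell U A B V -> cell V A' B' W -> cell U (A * A') (B * B') W;
  vcomp : forall (U U' W W' : DV) (A B C : DH),
    cell U A C W -> cell U' C B W' -> cell (U * U') A B (W * W');
  hcompA : forall U V W X A A' A'' B B' B''
      (a : cell U A B V) (b : cell V A' B' W) (c : cell W A'' B'' X),
    hcomp (hcomp a b) c =~ hcomp a (hcomp b c);
  hcomp1l : forall U W A B (a : cell U A B W), hcomp (hid U) a =~ a;
  hcomp1r : forall U W A B (a : cell U A B W), hcomp a (hid W) =~ a;
  vcompA : forall U U' U'' W W' W'' A B C D
      (a : cell U A B W) (b : cell U' B C W') (c : cell U'' C D W''),
    vcomp (vcomp a b) c =~ vcomp a (vcomp b c);
  vcomp1l : forall U W A B (a : cell U A B W), vcomp (vid A) a =~ a;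
  vcomp1r : forall U W A B (a : cell U A B W), vcomp a (vid B) =~ a;
  hid1 : hid 1 = vid 1;
  vidM : forall A B, vid (A * B) =~ hcomp (vid A) (vid B);
  hidM : forall U W, hid (U * W) =~ vcomp (hid U) (hid W);
  interchange : forall U U' V V' W W' A B C A' B' C'
      (a : cell U A C V) (b : cell U' C B V')
      (c : cell V A' C' W) (d : cell V' C' B' W'),
    hcomp (vcomp a b) (vcomp c d) = vcomp (hcomp a c) (hcomp b d)
}.
Arguments hid {DH DV s} U.
Arguments vid {DH DV s} A.
Arguments hcomp {DH DV s U V W A A' B B'} a b.
Arguments vcomp {DH DV s U U' W W' A B C} a b.

Section Congruence.
Variables (DH DV : monoid) (N : sodcat DH DV).

Lemma hcomp_cong U V W X X' Y Y' (a : N U X Y V) (b : N V X' Y' W)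
    U_ V_ W_ X_ X'_ Y_ Y'_ (a_ : N U_ X_ Y_ V_) (b_ : N V_ X'_ Y'_ W_) :
  a =~ a_ -> b =~ b_ -> hcomp a b =~ hcomp a_ b_.
Proof.
move=> ea; move: b_; destruct ea => b_ eb.
suff H : forall V' X'' Y'' W'' (c : N V' X'' Y'' W''), b =~ c ->
    forall e : V = V',
    hcomp a b =~ hcomp (cast_cell erefl erefl erefl e a) c.
  exact: (H _ _ _ _ _ eb erefl).
by move=> V' X'' Y'' W'' c [] e; rewrite (Prop_irrelevance e erefl).
Qed.

Lemma vcomp_cong U U' W W' X Y Z (a : N U X Z W) (b : N U' Z Y W')
    U_ U'_ W_ W'_ X_ Y_ Z_ (a_ : N U_ X_ Z_ W_) (b_ : N U'_ Z_ Y_ W'_) :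
  a =~ a_ -> b =~ b_ -> vcomp a b =~ vcomp a_ b_.
Proof.
move=> ea; move: b_; destruct ea => b_ eb.
suff H : forall U'' Z' Y'' W'' (c : N U'' Z' Y'' W''), b =~ c ->
    forall e : Z = Z',
    vcomp a b =~ vcomp (cast_cell erefl erefl e erefl a) c.
  exact: (H _ _ _ _ _ eb erefl).
by move=> U'' Z' Y'' W'' c [] e; rewrite (Prop_irrelevance e erefl).
Qed.

End Congruence.

(* The monoid presented by the generators, subject only to associativity and
   unitality, is the free monoid on the elements that are not products, which
   are A°, A•, U × W and U + W, where U and W are again elements of the
   monoid; [exch_initial] below states that it has the expected universal
   property. *)
Inductive exch_atom (O : Type) : Type :=
| ECirc of O
| EBul of O
| ETimes of seq (exch_atom O) & seq (exch_atom O)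
| EPlus of seq (exch_atom O) & seq (exch_atom O).

Definition exch (O : Type) : monoid :=
  @Monoid (seq (exch_atom O)) [::] cat
    (fun x y z => esym (catA x y z)) (@cat0s _) (@cats0 _).

Section Exch.
Variable O : Type.

Definition circ (A : O) : exch O := [:: ECirc A].
Definition bul (A : O) : exch O := [:: EBul A].
Definition etimes (U W : exch O) : exch O := [:: ETimes U W].
Definition eplus (U W : exch O) : exch O := [:: EPlus U W].

Definition is_exch_hom (M : monoid) (c b : O -> M) (t p : M -> M -> M)
    (F : exch O -> M) : Prop :=
  [/\ F 1 = 1, forall U W, F (U * W) = F U * F W,
      forall A, F (circ A) = c A /\ F (bul A) = b A,
      forall U W, F (etimes U W) = t (F U) (F W)
    & forall U W, F (eplus U W) = p (F U) (F W)].

Section Interp.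
Variables (M : monoid) (c b : O -> M) (t p : M -> M -> M).

Fixpoint atom_interp (x : exch_atom O) : M :=
  let seqi := fix seqi s : M :=
    if s is x :: s then atom_interp x * seqi s else 1 in
  match x with
  | ECirc A => c A
  | EBul A => b A
  | ETimes U W => t (seqi U) (seqi W)
  | EPlus U W => p (seqi U) (seqi W)
  end.

Definition exch_interp : exch O -> M := fix seqi s : M :=
  if s is x :: s then atom_interp x * seqi s else 1.

Lemma exch_initial : exists! F : exch O -> M, is_exch_hom c b t p F.
Proof.
exists exch_interp; split.
  split=> //=.
  - by elim=> [|x U IH] W /=; rewrite ?mmul1x // IH mmulA.
  - by split; rewrite /= mmulx1.
  - by move=> U W /=; rewrite mmulx1.
  - by move=> U W /=; rewrite mmulx1.
move=> F [F1 FM FA Ft Fp]; apply/funext.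
have Fnil : 1 = F [::] by rewrite -F1.
have Fcons x s : F [:: x] * F s = F (x :: s) by rewrite -FM.
suff atomE : forall x, atom_interp x = F [:: x].
  by elim=> [|x s IH] //=; rewrite atomE IH Fcons.
fix atomE 1 => -[X|X|U W|U W].
- exact/esym/(FA X).1.
- exact/esym/(FA X).2.
- rewrite [RHS]Ft /=; congr t.
    by elim: U => [|x s IH] //; rewrite IH atomE Fcons.
  by elim: W => [|x s IH] //; rewrite IH atomE Fcons.
- rewrite [RHS]Fp /=; congr p.
    by elim: U => [|x s IH] //; rewrite IH atomE Fcons.
  by elim: W => [|x s IH] //; rewrite IH atomE Fcons.
Qed.

End Interp.
End Exch.

(* Single-object double categories carrying the generating cells and satisfying
   the equations of the free cornering with choice. *)
Record cornering (A : dmcat) := Cornering {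
  sod :> sodcat (ob A) (exch (ob A));
  box : forall X Y : ob A, hom X Y -> sod 1 X Y 1;
  getL : forall X : ob A, sod (circ X) 1 X 1;
  putR : forall X : ob A, sod 1 X 1 (circ X);
  getR : forall X : ob A, sod 1 1 X (bul X);
  putL : forall X : ob A, sod (bul X) X 1 1;
  prj0 : forall U W, sod (etimes U W) 1 1 U;
  prj1 : forall U W, sod (etimes U W) 1 1 W;
  cprod : forall V X Y U W, sod V X Y U -> sod V X Y W -> sod V X Y (etimes U W);
  inj0 : forall U W, sod U 1 1 (eplus U W);
  inj1 : forall U W, sod W 1 1 (eplus U W);
  csum : forall U W X Y V, sod U X Y V -> sod W X Y V -> sod (eplus U W) X Y V;
  ccase : forall U X Y Z W, sod U X Z W -> sod U Y Z W -> sod U (oplus X Y) Z W;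
  box_comp : forall X Y Z (f : hom X Y) (g : hom Y Z),
    box (compm f g) =~ vcomp (box f) (box g);
  box_id : forall X, box (idm X) = vid X;
  box_tens : forall X Y X' Y' (f : hom X Y) (g : hom X' Y'),
    box (tens f g) =~ hcomp (box f) (box g);
  putR_getL : forall X, hcomp (putR X) (getL X) =~ vid X;
  getL_putR : forall X, vcomp (getL X) (putR X) =~ hid (circ X);
  getR_putL : forall X, hcomp (getR X) (putL X) =~ vid X;
  getR_putL_v : forall X, vcomp (getR X) (putL X) =~ hid (bul X);
  cprod0 : forall V X Y U W (a : sod V X Y U) (b : sod V X Y W),
    hcomp (cprod a b) (prj0 U W) =~ a;
  cprod1 : forall V X Y U W (a : sod V X Y U) (b : sod V X Y W),
    hcomp (cprod a b) (prj1 U W) =~ b;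
  cprod_uniq : forall V X Y U W (a : sod V X Y U) (b : sod V X Y W)
      (c : sod V X Y (etimes U W)),
    hcomp c (prj0 U W) =~ a -> hcomp c (prj1 U W) =~ b -> c = cprod a b;
  csum0 : forall U W X Y V (a : sod U X Y V) (b : sod W X Y V),
    hcomp (inj0 U W) (csum a b) =~ a;
  csum1 : forall U W X Y V (a : sod U X Y V) (b : sod W X Y V),
    hcomp (inj1 U W) (csum a b) =~ b;
  csum_uniq : forall U W X Y V (a : sod U X Y V) (b : sod W X Y V)
      (c : sod (eplus U W) X Y V),
    hcomp (inj0 U W) c =~ a -> hcomp (inj1 U W) c =~ b -> c = csum a b;
  ccase0 : forall U X Y Z W (a : sod U X Z W) (b : sod U Y Z W),
    vcomp (box (sig0 X Y)) (ccase a b) =~ a;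
  ccase1 : forall U X Y Z W (a : sod U X Z W) (b : sod U Y Z W),
    vcomp (box (sig1 X Y)) (ccase a b) =~ b;
  ccase_uniq : forall U X Y Z W (a : sod U X Z W) (b : sod U Y Z W)
      (c : sod U (oplus X Y) Z W),
    vcomp (box (sig0 X Y)) c =~ a -> vcomp (box (sig1 X Y)) c =~ b ->
    c = ccase a b
}.
Arguments box {A M X Y} f : rename.
Arguments getL {A M} X : rename.
Arguments putR {A M} X : rename.
Arguments getR {A M} X : rename.
Arguments putL {A M} X : rename.
Arguments prj0 {A M} U W : rename.
Arguments prj1 {A M} U W : rename.
Arguments cprod {A M V X Y U W} a b : rename.
Arguments inj0 {A M} U W : rename.
Arguments inj1 {A M} U W : rename.
Arguments csum {A M U W X Y V} a b : rename.
Arguments ccase {A M U X Y Z W} a b : rename.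

Record is_cornering_hom (A : dmcat) (M N : cornering A)
    (F : forall U X Y W, M U X Y W -> N U X Y W) : Prop := CorneringHom {
  chom_hid : forall U, F _ _ _ _ (hid U) = hid U;
  chom_vid : forall X, F _ _ _ _ (vid X) = vid X;
  chom_hcomp : forall U V W X X' Y Y' (a : M U X Y V) (b : M V X' Y' W),
    F _ _ _ _ (hcomp a b) = hcomp (F _ _ _ _ a) (F _ _ _ _ b);
  chom_vcomp : forall U U' W W' X Y Z (a : M U X Z W) (b : M U' Z Y W'),
    F _ _ _ _ (vcomp a b) = vcomp (F _ _ _ _ a) (F _ _ _ _ b);
  chom_box : forall X Y (f : hom X Y), F _ _ _ _ (box f) = box f;
  chom_getL : forall X, F _ _ _ _ (getL X) = getL X;
  chom_putR : forall X, F _ _ _ _ (putR X) = putR X;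
  chom_getR : forall X, F _ _ _ _ (getR X) = getR X;
  chom_putL : forall X, F _ _ _ _ (putL X) = putL X;
  chom_prj0 : forall U W, F _ _ _ _ (prj0 U W) = prj0 U W;
  chom_prj1 : forall U W, F _ _ _ _ (prj1 U W) = prj1 U W;
  chom_cprod : forall V X Y U W (a : M V X Y U) (b : M V X Y W),
    F _ _ _ _ (cprod a b) = cprod (F _ _ _ _ a) (F _ _ _ _ b);
  chom_inj0 : forall U W, F _ _ _ _ (inj0 U W) = inj0 U W;
  chom_inj1 : forall U W, F _ _ _ _ (inj1 U W) = inj1 U W;
  chom_csum : forall U W X Y V (a : M U X Y V) (b : M W X Y V),
    F _ _ _ _ (csum a b) = csum (F _ _ _ _ a) (F _ _ _ _ b);
  chom_ccase : forall U X Y Z W (a : M U X Z W) (b : M U Y Z W),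
    F _ _ _ _ (ccase a b) = ccase (F _ _ _ _ a) (F _ _ _ _ b)
}.

Section Free.
Variable A : dmcat.
Notation E := (exch (ob A)).

Inductive tm : E -> ob A -> ob A -> E -> Type :=
| Thid U : tm U 1 1 U
| Tvid X : tm 1 X X 1
| Thcomp U V W X X' Y Y' :
    tm U X Y V -> tm V X' Y' W -> tm U (X * X') (Y * Y') W
| Tvcomp U U' W W' X Y Z :
    tm U X Z W -> tm U' Z Y W' -> tm (U * U') X Y (W * W')
| Tbox X Y : hom X Y -> tm 1 X Y 1
| TgetL X : tm (circ X) 1 X 1
| TputR X : tm 1 X 1 (circ X)
| TgetR X : tm 1 1 X (bul X)
| TputL X : tm (bul X) X 1 1
| Tprj0 U W : tm (etimes U W) 1 1 U
| Tprj1 U W : tm (etimes U W) 1 1 W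
| Tprod V X Y U W : tm V X Y U -> tm V X Y W -> tm V X Y (etimes U W)
| Tinj0 U W : tm U 1 1 (eplus U W)
| Tinj1 U W : tm W 1 1 (eplus U W)
| Tsum U W X Y V : tm U X Y V -> tm W X Y V -> tm (eplus U W) X Y V
| Tcase U X Y Z W : tm U X Z W -> tm U Y Z W -> tm U (oplus X Y) Z W.

Reserved Notation "a ~ b" (at level 70, no associativity).

(* The congruence on terms generated by the equations of a cornering.  As these
   relate terms whose boundaries are only propositionally equal, it is
   heterogeneous. *)
Inductive teq : forall U X Y W, tm U X Y W ->
    forall U' X' Y' W', tm U' X' Y' W' -> Prop :=
| Trefl U X Y W (a : tm U X Y W) : a ~ a
| Tsym U X Y W (a : tm U X Y W) U' X' Y' W' (b : tm U' X' Y' W') :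
    a ~ b -> b ~ a
| Ttrans U X Y W (a : tm U X Y W) U' X' Y' W' (b : tm U' X' Y' W')
    U'' X'' Y'' W'' (c : tm U'' X'' Y'' W'') : a ~ b -> b ~ c -> a ~ c
| Chcomp U V W X X' Y Y' (a : tm U X Y V) (b : tm V X' Y' W)
    U_ V_ W_ X_ X'_ Y_ Y'_ (a_ : tm U_ X_ Y_ V_) (b_ : tm V_ X'_ Y'_ W_) :
    a ~ a_ -> b ~ b_ -> Thcomp a b ~ Thcomp a_ b_
| Cvcomp U U' W W' X Y Z (a : tm U X Z W) (b : tm U' Z Y W')
    U_ U'_ W_ W'_ X_ Y_ Z_ (a_ : tm U_ X_ Z_ W_) (b_ : tm U'_ Z_ Y_ W'_) :
    a ~ a_ -> b ~ b_ -> Tvcomp a b ~ Tvcomp a_ b_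
| Cprod V X Y U W (a a_ : tm V X Y U) (b b_ : tm V X Y W) :
    a ~ a_ -> b ~ b_ -> Tprod a b ~ Tprod a_ b_
| Csum U W X Y V (a a_ : tm U X Y V) (b b_ : tm W X Y V) :
    a ~ a_ -> b ~ b_ -> Tsum a b ~ Tsum a_ b_
| Ccase U X Y Z W (a a_ : tm U X Z W) (b b_ : tm U Y Z W) :
    a ~ a_ -> b ~ b_ -> Tcase a b ~ Tcase a_ b_
| ThcompA U V W Q X X' X'' Y Y' Y''
    (a : tm U X Y V) (b : tm V X' Y' W) (c : tm W X'' Y'' Q) :
    Thcomp (Thcomp a b) c ~ Thcomp a (Thcomp b c)
| Thcomp1l U W X Y (a : tm U X Y W) : Thcomp (Thid U) a ~ a
| Thcomp1r U W X Y (a : tm U X Y W) : Thcomp a (Thid W) ~ a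
| TvcompA U U' U'' W W' W'' X Y Z T
    (a : tm U X Y W) (b : tm U' Y Z W') (c : tm U'' Z T W'') :
    Tvcomp (Tvcomp a b) c ~ Tvcomp a (Tvcomp b c)
| Tvcomp1l U W X Y (a : tm U X Y W) : Tvcomp (Tvid X) a ~ a
| Tvcomp1r U W X Y (a : tm U X Y W) : Tvcomp a (Tvid Y) ~ a
| Thid1 : Thid 1 ~ Tvid 1
| TvidM X Y : Tvid (X * Y) ~ Thcomp (Tvid X) (Tvid Y)
| ThidM U W : Thid (U * W) ~ Tvcomp (Thid U) (Thid W)
| Tinterchange U U' V V' W W' X Y Z X' Y' Z'
    (a : tm U X Z V) (b : tm U' Z Y V')
    (c : tm V X' Z' W) (d : tm V' Z' Y' W') :
    Thcomp (Tvcomp a b) (Tvcomp c d) ~ Tvcomp (Thcomp a c) (Thcomp b d)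
| Tbox_comp X Y Z (f : hom X Y) (g : hom Y Z) :
    Tbox (compm f g) ~ Tvcomp (Tbox f) (Tbox g)
| Tbox_id X : Tbox (idm X) ~ Tvid X
| Tbox_tens X Y X' Y' (f : hom X Y) (g : hom X' Y') :
    Tbox (tens f g) ~ Thcomp (Tbox f) (Tbox g)
| TputR_getL X : Thcomp (TputR X) (TgetL X) ~ Tvid X
| TgetL_putR X : Tvcomp (TgetL X) (TputR X) ~ Thid (circ X)
| TgetR_putL X : Thcomp (TgetR X) (TputL X) ~ Tvid X
| TgetR_putL_v X : Tvcomp (TgetR X) (TputL X) ~ Thid (bul X)
| Tprod0 V X Y U W (a : tm V X Y U) (b : tm V X Y W) :
    Thcomp (Tprod a b) (Tprj0 U W) ~ a
| Tprod1 V X Y U W (a : tm V X Y U) (b : tm V X Y W) :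
    Thcomp (Tprod a b) (Tprj1 U W) ~ b
| Tprod_uniq V X Y U W (a : tm V X Y U) (b : tm V X Y W)
    (c : tm V X Y (etimes U W)) :
    Thcomp c (Tprj0 U W) ~ a -> Thcomp c (Tprj1 U W) ~ b -> c ~ Tprod a b
| Tsum0 U W X Y V (a : tm U X Y V) (b : tm W X Y V) :
    Thcomp (Tinj0 U W) (Tsum a b) ~ a
| Tsum1 U W X Y V (a : tm U X Y V) (b : tm W X Y V) :
    Thcomp (Tinj1 U W) (Tsum a b) ~ b
| Tsum_uniq U W X Y V (a : tm U X Y V) (b : tm W X Y V)
    (c : tm (eplus U W) X Y V) :
    Thcomp (Tinj0 U W) c ~ a -> Thcomp (Tinj1 U W) c ~ b -> c ~ Tsum a b
| Tcase0 U X Y Z W (a : tm U X Z W) (b : tm U Y Z W) :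
    Tvcomp (Tbox (sig0 X Y)) (Tcase a b) ~ a
| Tcase1 U X Y Z W (a : tm U X Z W) (b : tm U Y Z W) :
    Tvcomp (Tbox (sig1 X Y)) (Tcase a b) ~ b
| Tcase_uniq U X Y Z W (a : tm U X Z W) (b : tm U Y Z W)
    (c : tm U (oplus X Y) Z W) :
    Tvcomp (Tbox (sig0 X Y)) c ~ a -> Tvcomp (Tbox (sig1 X Y)) c ~ b ->
    c ~ Tcase a b
where "a ~ b" := (teq a b).

Lemma teq_boundary U X Y W (a : tm U X Y W) U' X' Y' W' (b : tm U' X' Y' W') :
  a ~ b -> [/\ U = U', X = X', Y = Y' & W = W'].
Proof.
by elim=> *; repeat match goal with H : [/\ _, _, _ & _] |- _ =>
    let H1 := fresh in let H2 := fresh in let H3 := fresh in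
    let H4 := fresh in case: H => H1 H2 H3 H4 end;
  split; try congruence; rewrite ?mmulA ?mmul1x ?mmulx1.
Qed.

Section Quotient.
Variables (U : E) (X Y : ob A) (W : E).

Definition teqb : rel {classic tm U X Y W} :=
  fun a b : tm U X Y W => `[< a ~ b >].

Lemma teqb_refl : reflexive teqb.
Proof. by move=> a; apply/asboolP; exact: Trefl. Qed.

Lemma teqb_sym : symmetric teqb.
Proof. by move=> a b; apply: asbool_equiv_eq; split; exact: Tsym. Qed.

Lemma teqb_trans : transitive teqb.
Proof.
move=> b a c /asboolP ab /asboolP bc; apply/asboolP; exact: Ttrans ab bc.
Qed.

Canonical teq_equiv := EquivRel teqb teqb_refl teqb_sym teqb_trans.

Definition fcell : Type := {eq_quot teq_equiv}%qT.

Definition cls (a : tm U X Y W) : fcell :=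
  (\pi_({eq_quot teq_equiv}%qT) (a : {classic tm U X Y W}))%qT.

Definition rep (x : fcell) : tm U X Y W := repr (x : {eq_quot teq_equiv}%qT).

Lemma repK x : cls (rep x) = x.
Proof. exact: reprK. Qed.

Lemma clsE (a b : tm U X Y W) : cls a = cls b <-> a ~ b.
Proof. by split=> [/eqmodP/asboolP//|ab]; apply/eqmodP/asboolP. Qed.

Lemma rep_cls (a : tm U X Y W) : rep (cls a) ~ a.
Proof. by apply/clsE; rewrite repK. Qed.

End Quotient.

(* The heterogeneous relation on terms does not identify more than equality of
   classes together with their boundaries. *)
Lemma cls_eq U X Y W (a : tm U X Y W) U' X' Y' W' (b : tm U' X' Y' W') :
  a ~ b <-> cls a =~ cls b.
Proof.
split=> [ab|].
  have [eU eX eY eW] := teq_boundary ab.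
  by subst U' X' Y' W'; apply/cell_eqE/clsE.
move: b; suff: forall U' X' Y' W' (y : fcell U' X' Y' W'),
    cls a =~ y -> a ~ rep y.
  by move=> H b /H ab; apply: Ttrans ab (rep_cls b).
by move=> {}U' {}X' {}Y' {}W' y []; apply/Tsym/rep_cls.
Qed.

Definition fhcomp U V W X X' Y Y' (x : fcell U X Y V) (y : fcell V X' Y' W) :=
  cls (Thcomp (rep x) (rep y)).
Definition fvcomp U U' W W' X Y Z (x : fcell U X Z W) (y : fcell U' Z Y W') :=
  cls (Tvcomp (rep x) (rep y)).
Definition fprod V X Y U W (x : fcell V X Y U) (y : fcell V X Y W) :=
  cls (Tprod (rep x) (rep y)).
Definition fsum U W X Y V (x : fcell U X Y V) (y : fcell W X Y V) :=
  cls (Tsum (rep x) (rep y)).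
Definition fcase U X Y Z W (x : fcell U X Z W) (y : fcell U Y Z W) :=
  cls (Tcase (rep x) (rep y)).

Lemma fhcompE U V W X X' Y Y' (a : tm U X Y V) (b : tm V X' Y' W) :
  fhcomp (cls a) (cls b) = cls (Thcomp a b).
Proof. by apply/clsE/Chcomp; exact: rep_cls. Qed.
Lemma fvcompE U U' W W' X Y Z (a : tm U X Z W) (b : tm U' Z Y W') :
  fvcomp (cls a) (cls b) = cls (Tvcomp a b).
Proof. by apply/clsE/Cvcomp; exact: rep_cls. Qed.
Lemma fprodE V X Y U W (a : tm V X Y U) (b : tm V X Y W) :
  fprod (cls a) (cls b) = cls (Tprod a b).
Proof. by apply/clsE/Cprod; exact: rep_cls. Qed.
Lemma fsumE U W X Y V (a : tm U X Y V) (b : tm W X Y V) :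
  fsum (cls a) (cls b) = cls (Tsum a b).
Proof. by apply/clsE/Csum; exact: rep_cls. Qed.
Lemma fcaseE U X Y Z W (a : tm U X Z W) (b : tm U Y Z W) :
  fcase (cls a) (cls b) = cls (Tcase a b).
Proof. by apply/clsE/Ccase; exact: rep_cls. Qed.

Definition fE := (fhcompE, fvcompE, fprodE, fsumE, fcaseE).

Lemma clsP U X Y W (P : fcell U X Y W -> Prop) :
  (forall a, P (cls a)) -> forall x, P x.
Proof. by move=> H x; rewrite -[x]repK. Qed.

Ltac cls_intro :=
  repeat lazymatch goal with
  | |- forall _ : fcell _ _ _ _, _ => elim/clsP; intro
  | |- forall _, _ => intro
  end.
Ltac free_tac := cls_intro; rewrite ?fE;
  first [ apply/cls_eq; by constructor | apply/clsE; by constructor ].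

Definition free_sodcat : sodcat (ob A) E.
Proof.
refine (@SODCat (ob A) E fcell
  (fun U => cls (Thid U)) (fun X => cls (Tvid X))
  fhcomp fvcomp _ _ _ _ _ _ _ _ _ _); abstract free_tac.
Defined.

(* Freeness, i.e. initiality among cornerings, is [free_map_hom] together with
   [free_map_uniq] below. *)
Definition free_cornering : cornering A.
Proof.
refine (@Cornering A free_sodcat
  (fun X Y f => cls (Tbox f))
  (fun X => cls (TgetL X)) (fun X => cls (TputR X))
  (fun X => cls (TgetR X)) (fun X => cls (TputL X))
  (fun U W => cls (Tprj0 U W)) (fun U W => cls (Tprj1 U W)) fprod
  (fun U W => cls (Tinj0 U W)) (fun U W => cls (Tinj1 U W)) fsum
  fcase _ _ _ _ _ _ _ _ _ _ _ _ _ _ _ _); rewrite /=;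
  try abstract free_tac.
- abstract (cls_intro; move: H H0; rewrite !fE => /cls_eq H /cls_eq H0;
            by apply/clsE/Tprod_uniq).
- abstract (cls_intro; move: H H0; rewrite !fE => /cls_eq H /cls_eq H0;
            by apply/clsE/Tsum_uniq).
- abstract (cls_intro; move: H H0; rewrite !fE => /cls_eq H /cls_eq H0;
            by apply/clsE/Tcase_uniq).
Defined.

Section Initial.
Variable N : cornering A.

Fixpoint interp U X Y W (a : tm U X Y W) : N U X Y W :=
  match a in tm U X Y W return N U X Y W with
  | Thid U => hid U
  | Tvid X => vid X
  | Thcomp _ _ _ _ _ _ _ a b => hcomp (interp a) (interp b)
  | Tvcomp _ _ _ _ _ _ _ a b => vcomp (interp a) (interp b)
  | Tbox _ _ f => box f
  | TgetL X => getL X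
  | TputR X => putR X
  | TgetR X => getR X
  | TputL X => putL X
  | Tprj0 U W => prj0 U W
  | Tprj1 U W => prj1 U W
  | Tprod _ _ _ _ _ a b => cprod (interp a) (interp b)
  | Tinj0 U W => inj0 U W
  | Tinj1 U W => inj1 U W
  | Tsum _ _ _ _ _ a b => csum (interp a) (interp b)
  | Tcase _ _ _ _ _ a b => ccase (interp a) (interp b)
  end.

Lemma interp_teq U X Y W (a : tm U X Y W) U' X' Y' W' (b : tm U' X' Y' W') :
  a ~ b -> interp a =~ interp b.
Proof.
elim; intros; cbn [interp];
  try by [exact: cell_eq_refl | exact: cell_eq_sym | exact: hcomp_cong
  | exact: vcomp_cong | apply: cell_eq_trans; eassumption];
  try by [exact: hcompA | exact: hcomp1l | exact: hcomp1r | exact: vcompA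
  | exact: vcomp1l | exact: vcomp1r | exact: vidM | exact: hidM
  | exact: box_comp | exact: box_tens | exact: putR_getL | exact: getL_putR
  | exact: getR_putL | exact: getR_putL_v | exact: cprod0 | exact: cprod1
  | exact: csum0 | exact: csum1 | exact: ccase0 | exact: ccase1];
  apply/cell_eqE;
  try by [exact: hid1 | exact: interchange | exact: box_id | exact: cprod_uniq
  | exact: csum_uniq | exact: ccase_uniq];
  by repeat match goal with H : interp _ =~ interp _ |- _ =>
    move/cell_eqE: H => -> end.
Qed.

Definition free_map U X Y W (x : free_cornering U X Y W) : N U X Y W :=
  interp (rep x).

Lemma free_mapE U X Y W (a : tm U X Y W) : free_map (cls a) = interp a.
Proof. by apply/cell_eqE/interp_teq/rep_cls. Qed.

Lemma free_map_hom : is_cornering_hom free_map.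
Proof. by split=> *; rewrite free_mapE. Qed.

Lemma free_map_uniq (F : forall U X Y W, free_cornering U X Y W -> N U X Y W) :
  is_cornering_hom F -> forall U X Y W x, F U X Y W x = free_map x.
Proof.
move=> [F1 F2 F3 F4 F5 F6 F7 F8 F9 F10 F11 F12 F13 F14 F15 F16] U X Y W.
elim/clsP=> a; rewrite free_mapE.
elim: a; intros; cbn [interp]; rewrite -?fE;
  first [exact: F1 | exact: F2 | exact: F5 | exact: F6 | exact: F7
  | exact: F8 | exact: F9 | exact: F10 | exact: F11 | exact: F13 | exact: F14
  | apply: etrans (F3 _ _ _ _ _ _ _ _ _) _
  | apply: etrans (F4 _ _ _ _ _ _ _ _ _) _
  | apply: etrans (F12 _ _ _ _ _ _ _) _
  | apply: etrans (F15 _ _ _ _ _ _ _) _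
  | apply: etrans (F16 _ _ _ _ _ _ _) _]; by congruence.
Qed.

End Initial.
End Free.

Section Crossing.
Variables (A : dmcat) (M : cornering A) (B : ob A).

Local Notation castH eX eY c := (cast_cell (C := cell M) erefl eX eY erefl c).

(* [crossing M B U] is the crossing cell with boundary (U; B; B; U).
   The casts only remove units in the horizontal edge monoid: composites of
   left and right boundaries in the exchange monoid compute. *)
Fixpoint crossing_atom (x : exch_atom (ob A)) : M [:: x] B B [:: x] :=
  let crossing_seq := fix crossing_seq (U : seq (exch_atom (ob A))) :
      M U B B U :=
    if U is x :: U' return M U B B U
    then vcomp (crossing_atom x) (crossing_seq U') else vid B in
  match x with
  | ECirc X => castH (mmul1x B) (mmulx1 B)
      (vcomp (vcomp (hcomp (getL X) (vid B)) (box (braid X B)))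
             (hcomp (vid B) (putR X)))
  | EBul X => castH (mmulx1 B) (mmul1x B)
      (vcomp (vcomp (hcomp (vid B) (getR X)) (box (braid B X)))
             (hcomp (putL X) (vid B)))
  | ETimes U W => castH (mmul1x B) (mmul1x B)
      (cprod (hcomp (prj0 U W) (crossing_seq U))
            (hcomp (prj1 U W) (crossing_seq W)))
  | EPlus U W => castH (mmulx1 B) (mmulx1 B)
      (csum (hcomp (crossing_seq U) (inj0 U W))
              (hcomp (crossing_seq W) (inj1 U W)))
  end.

Fixpoint crossing (U : exch (ob A)) : M U B B U :=
  if U is x :: U' return M U B B U
  then vcomp (crossing_atom x) (crossing U') else vid B.

Lemma crossing1 : crossing 1 = vid B.
Proof. by []. Qed.

Lemma crossing_seq1 x : crossing [:: x] =~ crossing_atom x.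
Proof. exact: (vcomp1r (crossing_atom x)). Qed.

Lemma crossing_circ X : crossing (circ X) =~
  vcomp (vcomp (hcomp (getL X) (vid B)) (box (braid X B)))
        (hcomp (vid B) (putR X)).
Proof. apply: (cell_eq_trans (C := cell M) (crossing_seq1 _)); exact: cast_cellE. Qed.

Lemma crossing_bul X : crossing (bul X) =~
  vcomp (vcomp (hcomp (vid B) (getR X)) (box (braid B X)))
        (hcomp (putL X) (vid B)).
Proof. apply: (cell_eq_trans (C := cell M) (crossing_seq1 _)); exact: cast_cellE. Qed.

Lemma crossing_mul U W : crossing (U * W) =~ vcomp (crossing U) (crossing W).
Proof.
elim: U => [|x U IH] /=; first exact/cell_eq_sym/(vcomp1l (crossing W)).
apply: cell_eq_trans (cell_eq_sym (vcompA (crossing_atom x) (crossing U) _)).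
exact: (vcomp_cong (N := M) (cell_eq_refl (crossing_atom x)) IH).
Qed.

Lemma crossing_plus U W : crossing (eplus U W) =~
  csum (hcomp (crossing U) (inj0 U W)) (hcomp (crossing W) (inj1 U W)).
Proof. apply: (cell_eq_trans (C := cell M) (crossing_seq1 _)); exact: cast_cellE. Qed.

Lemma crossing_times U W : crossing (etimes U W) =~
  cprod (hcomp (prj0 U W) (crossing U)) (hcomp (prj1 U W) (crossing W)).
Proof. apply: (cell_eq_trans (C := cell M) (crossing_seq1 _)); exact: cast_cellE. Qed.

End Crossing.

(* Main.v *)
(** The crossing cells are natural in their object: for every arrow [f : P -> Q]
    of [A], [f] on top of the crossing at [Q] equals the crossing at [P] on top
    of [f].  This goes by induction on the exchange.  At [X°] and [X•], [f]
    slides past the corner cells by interchange and past the braiding by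
    naturality of the braiding; at [U + W] and [U × W] both sides agree after
    composition with the injections (projections), by induction.  Naturality
    for the two coproduct injections is the claim, uniqueness being that of
    case cells. *)

From mathcomp Require Import ssreflect ssrfun ssrbool seq.
Require Import Defs.

Set Implicit Arguments.
Unset Strict Implicit.
Unset Printing Implicit Defensive.

Local Open Scope mon_scope.

(** A nonempty list is its first atom times the rest, so atoms suffice. The lists inside [ETimes]
    and [EPlus] need their own inductions, done within the [fix] so that [Pat] is only called on
    subterms. *)
Lemma exch_ind_mul (O : Type) (P : exch O -> Prop) :
  P 1 -> (forall U W, P U -> P W -> P (U * W)) ->
  (forall X, P (circ X)) -> (forall X, P (bul X)) ->
  (forall U W, P U -> P W -> P (etimes U W)) ->
  (forall U W, P U -> P W -> P (eplus U W)) ->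
  forall U, P U.
Proof.
move=> P1 PM Pc Pb Pt Pp.
suff Pat : forall x, P [:: x].
  by elim=> [|x s IH] //; exact: (PM [:: x] s).
fix Pat 1 => -[X|X|U W|U W]; [exact: Pc|exact: Pb|apply: Pt|apply: Pp].
- by elim: U => [|x s IH] //; exact: (PM [:: x] s).
- by elim: W => [|x s IH] //; exact: (PM [:: x] s).
- by elim: U => [|x s IH] //; exact: (PM [:: x] s).
- by elim: W => [|x s IH] //; exact: (PM [:: x] s).
Qed.

Section Whiskering.
Variables (DH DV : monoid) (N : sodcat DH DV).

Lemma vid1_hcomp W P Q (a : N 1 P Q W) : hcomp (vid 1) a =~ a.
Proof. by rewrite -hid1; exact: hcomp1l. Qed.

Lemma hcomp_vid1 U P Q (a : N U P Q 1) : hcomp a (vid 1) =~ a.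
Proof. by rewrite -hid1; exact: hcomp1r. Qed.

(** By interchange, both sides are [hcomp g h] up to vertical units. *)
Lemma vid_slide_left U S T P Q (g : N U S T 1) (h : N 1 P Q 1) :
  vcomp (hcomp (vid S) h) (hcomp g (vid Q))
    =~ vcomp (hcomp g (vid P)) (hcomp (vid T) h).
Proof.
rewrite -!interchange.
apply: (hcomp_cong (N := N)).
  exact: cell_eq_trans (vcomp1l g) (cell_eq_sym (vcomp1r g)).
exact: cell_eq_trans (vcomp1r h) (cell_eq_sym (vcomp1l h)).
Qed.

Lemma vid_slide_right W S T P Q (g : N 1 S T W) (h : N 1 P Q 1) :
  vcomp (hcomp h (vid S)) (hcomp (vid Q) g)
    =~ vcomp (hcomp (vid P) g) (hcomp h (vid T)).
Proof.
rewrite -!interchange.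
apply: (hcomp_cong (N := N)).
  exact: cell_eq_trans (vcomp1r h) (cell_eq_sym (vcomp1l h)).
exact: cell_eq_trans (vcomp1l g) (cell_eq_sym (vcomp1r g)).
Qed.

(** Naturality squares stack vertically. This serves products of exchanges as well as the three rows
    of a corner crossing. *)
Lemma vcomp_slide U U' W W' P Q P1 Q1 P2 Q2
    (h : N 1 P Q 1) (h1 : N 1 P1 Q1 1) (h2 : N 1 P2 Q2 1)
    (p : N U P P1 W) (q : N U Q Q1 W) (p' : N U' P1 P2 W') (q' : N U' Q1 Q2 W') :
  vcomp h q =~ vcomp p h1 -> vcomp h1 q' =~ vcomp p' h2 ->
  vcomp h (vcomp q q') =~ vcomp (vcomp p p') h2.
Proof.
move=> e1 e2.
apply: cell_eq_trans (cell_eq_sym (vcompA _ _ _)) _.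
apply: cell_eq_trans (vcomp_cong (N := N) e1 (cell_eq_refl q')) _.
apply: cell_eq_trans (vcompA _ _ _) _.
apply: cell_eq_trans (vcomp_cong (N := N) (cell_eq_refl p) e2) _.
exact: cell_eq_sym (vcompA _ _ _).
Qed.

Section Intertwining.
Variables (U V : DV) (P Q : DH) (i : N U 1 1 V) (h : N 1 P Q 1).
Variables (cP : N V P P V) (cQ : N V Q Q V) (dP : N U P P U) (dQ : N U Q Q U).
Hypotheses (iP : hcomp i cP =~ hcomp dP i) (iQ : hcomp i cQ =~ hcomp dQ i).

Lemma swap_vid1 : hcomp (vid 1) h =~ hcomp h (vid 1).
Proof. exact: cell_eq_trans (vid1_hcomp h) (cell_eq_sym (hcomp_vid1 h)). Qed.

Lemma swap_unit : vcomp (vid 1) i =~ vcomp i (vid 1).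
Proof. exact: cell_eq_trans (vcomp1l i) (cell_eq_sym (vcomp1r i)). Qed.

(** Here [i] is an injection and [c] the crossing at the sum. Interchange moves [i] to the right,
    turning [c] into [d]; the square for [d] applies, and [i] moves back. *)
Lemma natural_whisker_left : vcomp h dQ =~ vcomp dP h ->
  hcomp (vcomp (vid 1) i) (vcomp h cQ) =~ hcomp (vcomp i (vid 1)) (vcomp cP h).
Proof.
move=> hd; rewrite !interchange.
apply: cell_eq_trans (vcomp_cong (N := N) swap_vid1 iQ) _.
apply: cell_eq_trans (cell_eq_sym (vcomp_cong (N := N) iP swap_vid1)).
by rewrite -!interchange; exact: hcomp_cong hd swap_unit.
Qed.

(** The dual case: [i] is a projection and [d] the crossing at the product. *)
Lemma natural_whisker_right : vcomp h cQ =~ vcomp cP h ->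
  hcomp (vcomp h dQ) (vcomp (vid 1) i) =~ hcomp (vcomp dP h) (vcomp i (vid 1)).
Proof.
move=> hc; rewrite !interchange.
apply: cell_eq_trans (cell_eq_sym (vcomp_cong (N := N) swap_vid1 iQ)) _.
apply: cell_eq_trans (vcomp_cong (N := N) iP swap_vid1).
by rewrite -!interchange; exact: hcomp_cong swap_unit hc.
Qed.

End Intertwining.
End Whiskering.

Section Naturality.
Variables (A : dmcat) (M : cornering A).
Local Notation refl := (cell_eq_refl _).
Local Notation trans := (cell_eq_trans (C := cell M)).
Local Notation sym := (cell_eq_sym (C := cell M)).
Local Notation vcong := (vcomp_cong (N := M)).
Local Notation hcong := (hcomp_cong (N := M)).

Lemma csum_ext U W X Y V (c d : M (eplus U W) X Y V) :
  hcomp (inj0 U W) c =~ hcomp (inj0 U W) d ->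
  hcomp (inj1 U W) c =~ hcomp (inj1 U W) d -> c = d.
Proof.
(* Composing with an injection leaves the boundaries [1 * X] and [1 * Y], while [csum] is applied at
   [X] and [Y]; [k] removes the units. *)
pose k T (e : M T (1 * X) (1 * Y) V) :=
  cast_cell (C := cell M) erefl (mmul1x X) (mmul1x Y) erefl e.
have kE T e : e =~ @k T e by apply/sym/cast_cellE.
move=> e0 e1; transitivity (csum (k _ (hcomp (inj0 U W) d))
                                 (k _ (hcomp (inj1 U W) d))).
  by apply: csum_uniq; [apply: trans e0 _|apply: trans e1 _]; exact: kE.
by apply/esym/csum_uniq; exact: kE.
Qed.

Lemma cprod_ext V X Y U W (c d : M V X Y (etimes U W)) :
  hcomp c (prj0 U W) =~ hcomp d (prj0 U W) ->
  hcomp c (prj1 U W) =~ hcomp d (prj1 U W) -> c = d.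
Proof.
pose k T (e : M V (X * 1) (Y * 1) T) :=
  cast_cell (C := cell M) erefl (mmulx1 X) (mmulx1 Y) erefl e.
have kE T e : e =~ @k T e by apply/sym/cast_cellE.
move=> e0 e1; transitivity (cprod (k _ (hcomp d (prj0 U W)))
                                  (k _ (hcomp d (prj1 U W)))).
  by apply: cprod_uniq; [apply: trans e0 _|apply: trans e1 _]; exact: kE.
by apply/esym/cprod_uniq; exact: kE.
Qed.

(** The side boundaries of [c] and of the case cell are kept apart because in the application they
    are [U] and [U * 1], equal only propositionally. The first hypothesis forces them to agree. *)
Lemma ccase_eq U W X Y Z U' W' (a : M U X Z W) (b : M U Y Z W)
    (c : M U' (oplus X Y) Z W') :
  vcomp (box (sig0 X Y)) c =~ a -> vcomp (box (sig1 X Y)) c =~ b ->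
  c =~ ccase a b.
Proof.
have bdry (Z' : ob A) V R (d : M V X Z' R) : d =~ a -> V = U /\ R = W.
  by case.
move=> ca cb; have [eU eW] := bdry _ _ _ _ ca.
rewrite !mmul1x in eU eW; subst U' W'.
by apply/cell_eqE/ccase_uniq.
Qed.

Section Arrow.
Variables (P Q : ob A) (f : hom P Q).

Lemma box_vid_left X : hcomp (vid X) (box f) =~ box (M := M) (tens (idm X) f).
Proof. by rewrite -box_id; exact/sym/box_tens. Qed.

Lemma box_vid_right X : hcomp (box f) (vid X) =~ box (M := M) (tens f (idm X)).
Proof. by rewrite -box_id; exact/sym/box_tens. Qed.

Lemma box_braid_left X :
  vcomp (hcomp (vid X) (box f)) (box (braid X Q))
    =~ vcomp (box (M := M) (braid X P)) (hcomp (box f) (vid X)).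
Proof.
apply: trans (vcong (box_vid_left X) refl) _.
apply: trans (sym (box_comp M _ _)) _; rewrite braid_nat.
apply: trans (box_comp M _ _) _.
exact: (vcong refl (sym (box_vid_right X))).
Qed.

Lemma box_braid_right X :
  vcomp (hcomp (box f) (vid X)) (box (braid Q X))
    =~ vcomp (box (M := M) (braid P X)) (hcomp (vid X) (box f)).
Proof.
apply: trans (vcong (box_vid_right X) refl) _.
apply: trans (sym (box_comp M _ _)) _; rewrite braid_nat.
apply: trans (box_comp M _ _) _.
exact: (vcong refl (sym (box_vid_left X))).
Qed.

Lemma crossing_natural (U : exch (ob A)) :
  vcomp (box f) (crossing M Q U) =~ vcomp (crossing M P U) (box f).
Proof.
(* Without casts, the crossing at [X°] runs from [1 * B] to [B * 1], and at [X•] the other way: [f]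
   enters padded by a unit on one side and leaves padded on the other. *)
have b1f : box (M := M) f =~ hcomp (vid 1) (box f) by exact/sym/vid1_hcomp.
have bf1 : box (M := M) f =~ hcomp (box f) (vid 1) by exact/sym/hcomp_vid1.
elim/exch_ind_mul: U => [|U W IHU IHW|X|X|U W IHU IHW|U W IHU IHW].
- exact: trans (vcomp1r (s := M) (box f)) (sym (vcomp1l (s := M) (box f))).
- apply: trans (vcong refl (crossing_mul M Q U W)) _.
  apply: trans (sym (vcong (crossing_mul M P U W) refl)).
  exact: vcomp_slide IHU IHW.
- apply: trans (vcong b1f (crossing_circ M Q X)) _.
  apply: trans (sym (vcong (crossing_circ M P X) bf1)).
  apply: vcomp_slide (vid_slide_right _ _).
  exact: vcomp_slide (vid_slide_left _ _) (box_braid_left _).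
- apply: trans (vcong bf1 (crossing_bul M Q X)) _.
  apply: trans (sym (vcong (crossing_bul M P X) b1f)).
  apply: vcomp_slide (vid_slide_left _ _).
  exact: vcomp_slide (vid_slide_right _ _) (box_braid_right _).
- apply/cell_eqE.
  have pE B : hcomp (crossing M B (etimes U W)) (prj0 U W)
       =~ hcomp (prj0 U W) (crossing M B U).
    exact: trans (hcong (crossing_times M B U W) refl) (cprod0 _ _).
  have qE B : hcomp (crossing M B (etimes U W)) (prj1 U W)
       =~ hcomp (prj1 U W) (crossing M B W).
    exact: trans (hcong (crossing_times M B U W) refl) (cprod1 _ _).
  apply: cprod_ext.
    (* A vertical unit splits the projection into two rows, so that interchange can pair them with
       the two rows of the square. *)
    apply: trans (hcong refl (sym (vcomp1l (prj0 U W)))) _.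
    apply: trans _ (hcong refl (vcomp1r (prj0 U W))).
    exact: natural_whisker_right (sym (pE P)) (sym (pE Q)) IHU.
  apply: trans (hcong refl (sym (vcomp1l (prj1 U W)))) _.
  apply: trans _ (hcong refl (vcomp1r (prj1 U W))).
  exact: natural_whisker_right (sym (qE P)) (sym (qE Q)) IHW.
- apply/cell_eqE.
  have iE B : hcomp (inj0 U W) (crossing M B (eplus U W))
       =~ hcomp (crossing M B U) (inj0 U W).
    exact: trans (hcong refl (crossing_plus M B U W)) (csum0 _ _).
  have jE B : hcomp (inj1 U W) (crossing M B (eplus U W))
       =~ hcomp (crossing M B W) (inj1 U W).
    exact: trans (hcong refl (crossing_plus M B U W)) (csum1 _ _).
  apply: csum_ext.
    apply: trans (hcong (sym (vcomp1l (inj0 U W))) refl) _.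
    apply: trans _ (hcong (vcomp1r (inj0 U W)) refl).
    exact: natural_whisker_left (iE P) (iE Q) IHU.
  apply: trans (hcong (sym (vcomp1l (inj1 U W))) refl) _.
  apply: trans _ (hcong (vcomp1r (inj1 U W)) refl).
  exact: natural_whisker_left (jE P) (jE Q) IHW.
Qed.

End Arrow.
End Naturality.

Theorem lemma14 (A : dmcat) (U : exch (ob A)) (X Y : ob A) :
  crossing (free_cornering A) (oplus X Y) U
    =~ ccase (vcomp (crossing (free_cornering A) X U) (box (sig0 X Y)))
             (vcomp (crossing (free_cornering A) Y U) (box (sig1 X Y)))
  /\ unique
       (fun c : free_cornering A U (oplus X Y) (oplus X Y) U =>
          vcomp (box (sig0 X Y)) c
            =~ vcomp (crossing (free_cornering A) X U) (box (sig0 X Y))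
          /\ vcomp (box (sig1 X Y)) c
            =~ vcomp (crossing (free_cornering A) Y U) (box (sig1 X Y)))
       (crossing (free_cornering A) (oplus X Y) U).
Proof.
set M := free_cornering A.
have nat0 := crossing_natural M (sig0 X Y) U.
have nat1 := crossing_natural M (sig1 X Y) U.
split; first exact: ccase_eq.
split=> // c [c0 c1]; apply/cell_eqE.
(* The crossing and [c] are compared through the one case cell that both equal. *)
apply: cell_eq_trans (ccase_eq nat0 nat1) _.
exact: cell_eq_sym (ccase_eq c0 c1).
Qed.
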